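(* Let $G$ be a locally residually torsion-free nilpotent group. Then every maximal cyclic subgroup of $G$ is left relatively convex in $G$.
   Context: A group $H$ is residually torsion-free nilpotent if for each nontrivial $h\in H$ there is a homomorphism from $H$ onto a torsion-free nilpotent group under which the image of $h$ is nontrivial. A group $G$ is locally residually torsion-free nilpotent if every finitely generated subgroup of $G$ is residually torsion-free nilpotent. A maximal cyclic subgroup is a subgroup that is maximal, with respect to inclusion, among the cyclic subgroups. An order on a set is a transitive, trichotomous binary relation (a strict total order). A subgroup $H$ of a group $G$ is left relatively convex in $G$ if the left $G$-set $G/H$ of left cosets admits at least one $G$-invariant order. *)

(* Defs.v *)
From HB Require Import structures.
From mathcomp Require Import all_boot boolp classical_sets.

Set Implicit Arguments.
Unset Strict Implicit.
Unset Printing Implicit Defensive.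

Local Open Scope classical_set_scope.
Local Open Scope group_scope.

Record subgroup (G : groupType) := Subgroup {
  subgroup_set :> set G;
  subgroup_closed : group_closed (mem subgroup_set)
}.

(* The subgroup H regarded as a group in its own right, with the operations of
   G; its elements are the pairs {x : G | x \in H}. *)
Definition subgroup_type (G : groupType) (H : subgroup G) : Type :=
  set_type H.

HB.instance Definition _ (G : groupType) (H : subgroup G) :=
  SubChoice.on (subgroup_type H).
HB.instance Definition _ (G : groupType) (H : subgroup G) :=
  SubChoice_isSubGroup.Build G (mem (subgroup_set H)) (subgroup_type H)
    (subgroup_closed H).

Definition generated (G : groupType) (A : set G) : set G :=
  smallest (fun B : set G => group_closed (mem B)) A.

Definition finitely_generated (G : groupType) (H : set G) : Prop :=
  exists s : seq G, H = generated [set` s].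

Definition cyclic_subgroup (G : groupType) (H : set G) : Prop :=
  exists x : G, H = generated [set x].

Definition maximal_cyclic_subgroup (G : groupType) (C : set G) : Prop :=
  cyclic_subgroup C /\
  forall D : set G, cyclic_subgroup D -> C `<=` D -> D = C.

Definition torsion_free (G : groupType) : Prop :=
  forall (x : G) (n : nat), (0 < n)%N -> x ^+ n = 1 -> x = 1.

(* Indexed so that the 0th term is G itself. *)
Fixpoint lower_central (G : groupType) (n : nat) : set G :=
  if n is m.+1 then
    generated [set z | exists2 x, lower_central m x
                              & exists y : G, z = [~ x, y]]
  else setT.
Arguments lower_central : clear implicits.

Definition nilpotent_group (G : groupType) : Prop :=
  exists n : nat, lower_central G n = [set 1].

Definition residually_torsion_free_nilpotent (H : groupType) : Prop :=
  forall h : H, h <> 1 ->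
  exists (N : groupType) (f : {multiplicative H -> N}),
    [/\ torsion_free N, nilpotent_group N, (forall y, exists x, f x = y)
      & f h <> 1].

Definition locally_residually_torsion_free_nilpotent (G : groupType) : Prop :=
  forall H : subgroup G, finitely_generated H ->
  residually_torsion_free_nilpotent (subgroup_type H).

(* The left translate g A; the action of G on its left cosets. *)
Definition translate (G : groupType) (g : G) (A : set G) : set G :=
  [set g * a | a in A].

Definition left_cosets (G : groupType) (H : set G) : set (set G) :=
  [set translate g H | g in [set: G]].

(* Only the restriction of lt to X matters; trichotomy means that exactly one
   of lt x y, x = y, lt y x holds. *)
Definition order_on (T : Type) (X : set T) (lt : T -> T -> Prop) : Prop :=
  (forall x y z, X x -> X y -> X z -> lt x y -> lt y z -> lt x z) /\
  (forall x y, X x -> X y ->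
     [\/ [/\ lt x y, x <> y & ~ lt y x],
         [/\ ~ lt x y, x = y & ~ lt y x]
       | [/\ ~ lt x y, x <> y & lt y x]]).

Definition left_relatively_convex (G : groupType) (H : set G) : Prop :=
  exists lt : set G -> set G -> Prop,
    order_on (left_cosets H) lt /\
    forall (g : G) (A B : set G), left_cosets H A -> left_cosets H B ->
      (lt (translate g A) (translate g B) <-> lt A B).

(* Main.v *)
Require Import Defs.
From HB Require Import structures.
From mathcomp Require Import all_boot all_order all_algebra boolp classical_sets.
From mathcomp Require Import generic_quotient filter zify lra.

Set Implicit Arguments.
Unset Strict Implicit.
Unset Printing Implicit Defensive.

Import GRing.Theory Num.Theory Order.TTheory.
Local Open Scope classical_set_scope.
Local Open Scope group_scope.

(** By compactness it is enough to find, for each finite set X disjoint from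
    C = <c>, a C-bi-invariant subsemigroup avoiding C and containing x or x^-1
    for each x in X.  Let H be the subgroup generated by X and c.  If every
    element of H has a positive power in [H, H]<c>, then the factors of the
    lower central series of H below H / [H, H] are torsion, so that H, being
    residually torsion-free nilpotent, is abelian; it is then cyclic, and H = C
    by maximality.  Otherwise there is a homomorphism phi : H -> Q with
    phi c = 0 and phi nonzero on X: elements with phi > 0 are declared positive,
    and the smaller set of those x in X with phi x = 0 is treated by
    induction. *)

(** * Subgroups, normal closure and cyclic subgroups *)

Section GroupBasics.
Variable G : groupType.
Implicit Types (A B M : set G) (x y z : G).

Definition is_subgroup B := B 1 /\ forall x y, B x -> B y -> B (x / y).

Lemma is_subgroupP B : is_subgroup B <-> group_closed (mem B).
Proof.
split=> [[B1 BF]|[B1 BF]]; split.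
- by rewrite !inE.
- by move=> x y; rewrite !inE; apply: BF.
- by move: B1; rewrite !inE.
- by move=> x y Bx By; have := BF x y; rewrite !inE; apply.
Qed.

Lemma subgroupV B x : is_subgroup B -> B x -> B x^-1.
Proof. by case=> B1 BF Bx; rewrite -div1g; apply: BF. Qed.

Lemma subgroupM B x y : is_subgroup B -> B x -> B y -> B (x * y).
Proof.
by move=> gB Bx By; rewrite -(invgK y); apply: gB.2 => //; apply: subgroupV.
Qed.

Lemma subgroupX B x n : is_subgroup B -> B x -> B (x ^+ n).
Proof.
move=> gB Bx; elim: n => [|n IHn]; first exact: gB.1.
by rewrite expgS; apply: subgroupM.
Qed.

Lemma subgroup_divC B x y : is_subgroup B -> B (x / y) -> B (y / x).
Proof. by move=> gB /(subgroupV gB); rewrite invgF. Qed.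

Lemma generated_subgroup A : is_subgroup (generated A).
Proof.
split=> [|x y Hx Hy] B; move=> [] /(is_subgroupP B).2 gB AB; first exact: gB.1.
by apply: gB.2; [apply: Hx | apply: Hy]; split => //; apply/(is_subgroupP B).1.
Qed.

Lemma generated_min A B : is_subgroup B -> A `<=` B -> generated A `<=` B.
Proof. by move=> /is_subgroupP gB AB; apply: smallest_sub. Qed.

Lemma sub_generated A : A `<=` generated A.
Proof. exact: sub_gen_smallest. Qed.

Definition is_normal M := is_subgroup M /\ forall x y, M x -> M (x ^ y).

(** The elements all of whose conjugates lie in [generated A] form a subgroup, so it suffices to
    test conjugates of generators. *)
Lemma generated_normal A :
  (forall x y, A x -> generated A (x ^ y)) -> is_normal (generated A).
Proof.
move=> AJ; split=> [|x y Hx]; first exact: generated_subgroup.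
suff /(_ x Hx) : generated A `<=` [set x | forall y, generated A (x ^ y)] by apply.
apply: generated_min; last by move=> z Az t; apply: AJ.
split=> [t|a b Ha Hb t]; first by rewrite conj1g; apply: (generated_subgroup A).1.
by rewrite conjMg conjVg; apply: (generated_subgroup A).2.
Qed.

Lemma generated1P x y :
  generated [set x] y <-> exists n, y = x ^+ n \/ y = x ^- n.
Proof.
split; last first.
  have gx : generated [set x] x by apply: sub_generated.
  have gX := generated_subgroup [set x].
  have gxn n : generated [set x] (x ^+ n) by apply: subgroupX gX _; apply: sub_generated.
  by move=> [n [->|->]]; [exact: gxn | exact: subgroupV gX (gxn n)].
move: y; apply: generated_min; last by move=> _ ->; exists 1%N; left.
split=> [|a b]; first by exists 0%N; left.
have main m n : exists k, x ^+ m / x ^+ n = x ^+ k \/ x ^+ m / x ^+ n = x ^- k.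
  have [lenm|/ltnW lemn] := leqP n m.
    by exists (m - n)%N; left; rewrite expgnFr.
  by exists (n - m)%N; right; rewrite expgnFr // invgF.
have cx m n : commute (x ^+ m) (x ^+ n) by apply: commuteX2.
move=> [m [->|->]] [n [->|->]].
- exact: main.
- by rewrite invgK -expgnDr; exists (m + n)%N; left.
- by exists (n + m)%N; right; rewrite -invgM -expgnDr.
- have := main n m; rewrite invgK; rewrite -(commuteV _) //.
Qed.

End GroupBasics.

(** * Commutator calculus and torsion in the lower central factors *)

Section LowerCentralSeries.
Variable G : groupType.
Implicit Types (M : set G) (x y z : G).

Lemma commMgl x y z : [~ x * y, z] = [~ x, z] ^ y * [~ y, z].
Proof. by rewrite /commg /conjg ?gnorm; gsimpl. Qed.

Lemma commgMr x y z : [~ x, y * z] = [~ x, z] * [~ x, y] ^ z.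
Proof. by rewrite /commg /conjg ?gnorm; gsimpl. Qed.

Lemma normal_commg M x y : is_normal M -> M x -> M [~ x, y].
Proof.
move=> [gM MJ] Mx; rewrite commgEl.
by apply: (subgroupM gM); [apply: subgroupV | apply: MJ].
Qed.

Lemma normal_conjV M x y : is_normal M -> M x -> M (y * x * y^-1).
Proof. by move=> [_ MJ] /(MJ _ y^-1); rewrite conjgE invgK mulgA. Qed.

(** Modulo [M], [x] commutes with every [[~ x ^+ k, y]], so the conjugation in [[~ x ^+ k.+1, y] =
    [~ x ^+ k, y] ^ x * [~ x, y]] disappears and the commutators multiply up. *)
Lemma normal_commXg M x y n : is_normal M ->
  (forall k, M [~ [~ x ^+ k, y], x]) -> M ([~ x ^+ n, y] / [~ x, y] ^+ n).
Proof.
move=> nM Mx; have gM := nM.1; elim: n => [|n IHn].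
  by rewrite !expg0 comm1g divg1; apply: gM.1.
set a := [~ x ^+ n, y] in IHn; set b := [~ x, y] in IHn *.
have -> : [~ x ^+ n.+1, y] / b ^+ n.+1
    = (a / b ^+ n) * (b ^+ n * [~ a, x] * (b ^+ n)^-1).
  rewrite !expgSr commMgl -/a -/b (commgEl a); clearbody a b.
  by rewrite /conjg ?gnorm; gsimpl.
by apply: (subgroupM gM) => //; apply: normal_conjV => //; apply: Mx.
Qed.

Lemma normal_commgX M x y n : is_normal M ->
  (forall k, M [~ [~ x, y ^+ k], y]) -> M ([~ x, y ^+ n] / [~ x, y] ^+ n).
Proof.
move=> nM My; have gM := nM.1; elim: n => [|n IHn].
  by rewrite !expg0 commg1 divg1; apply: gM.1.
set a := [~ x, y ^+ n] in IHn; set b := [~ x, y] in IHn *.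
have -> : [~ x, y ^+ n.+1] / b ^+ n.+1
    = (b * (a / b ^+ n) * b^-1) * (b ^+ n.+1 * [~ a, y] * (b ^+ n.+1)^-1).
  rewrite expgSr commgMr -/a -/b (commgEl a) expgS; clearbody a b.
  by rewrite /conjg ?gnorm; gsimpl.
by apply: (subgroupM gM); apply: normal_conjV => //; apply: My.
Qed.

(** This is the isolator of [M]. It need not be closed under products, whence the commutator
    condition in [radicalM]. *)
Definition radical M : set G := [set x | exists2 n, (0 < n)%N & M (x ^+ n)].

(** The images of [x] and [y] in the quotient by [M] commute; the computation is carried out in [G],
    without forming the quotient. *)
Lemma normal_expMg M x y n : is_normal M -> M [~ y, x] ->
  M ((x ^+ n * y ^+ n)^-1 * (x * y) ^+ n).
Proof.
move=> nM Mxy; have gM := nM.1.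
have Mc k : M [~ y, x ^+ k].
  elim: k => [|k IHk]; first by rewrite expg0 commg1; apply: gM.1.
  by rewrite expgSr commgMr; apply: (subgroupM gM) => //; apply: nM.2.
elim: n => [|n IHn]; first by rewrite !expg0 !mulg1 invg1; apply: gM.1.
have -> : (x ^+ n.+1 * y ^+ n.+1)^-1 * (x * y) ^+ n.+1
    = [~ y, x ^+ n] ^ y ^+ n * ((x ^+ n * y ^+ n)^-1 * (x * y) ^+ n).
  by rewrite !expgS /commg /conjg ?gnorm; gsimpl.
by apply: (subgroupM gM) => //; apply: nM.2.
Qed.

Lemma radicalM M x y : is_normal M -> M [~ y, x] ->
  radical M x -> radical M y -> radical M (x * y).
Proof.
move=> nM Mxy [n n0 Mx] [m m0 My]; have gM := nM.1.
exists (n * m)%N; first by rewrite muln_gt0 n0.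
rewrite -(mulVKg (x ^+ (n * m) * y ^+ (n * m)) ((x * y) ^+ _)).
apply: (subgroupM gM); last exact: normal_expMg.
apply: (subgroupM gM); first by rewrite expgnA; apply: subgroupX.
by rewrite mulnC expgnA; apply: subgroupX.
Qed.

Lemma radicalV M x : is_subgroup M -> radical M x -> radical M x^-1.
Proof. by move=> gM [n n0 Mx]; exists n => //; rewrite expVgn; apply: subgroupV. Qed.

Lemma radicalX M x n : (0 < n)%N -> radical M (x ^+ n) -> radical M x.
Proof.
by move=> n0 [m m0]; rewrite -expgnA; exists (n * m)%N; rewrite ?muln_gt0 ?n0.
Qed.

Lemma radical_sub M : M `<=` radical M.
Proof. by move=> x Mx; exists 1%N. Qed.

Local Notation gamma := (lower_central G).

Lemma commg_lower_central n x y : gamma n x -> gamma n.+1 [~ x, y].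
Proof. by move=> gx; apply: sub_generated => /=; exists x => //; exists y. Qed.

Lemma lower_central_normal n : is_normal (gamma n).
Proof.
elim: n => [|n IHn]; first by split.
apply: generated_normal => _ y [x gx [z ->]].
by rewrite conjRg; apply: commg_lower_central; apply: IHn.2.
Qed.

Lemma lower_central_subgroup n : is_subgroup (gamma n).
Proof. exact: (lower_central_normal n).1. Qed.
Hint Resolve lower_central_normal lower_central_subgroup : core.

Lemma lower_centralS n : gamma n.+1 `<=` gamma n.
Proof. by apply: generated_min => // _ [x gx [y ->]]; apply: normal_commg. Qed.

Lemma commg_lower_central_r n x y : gamma n y -> gamma n.+1 [~ x, y].
Proof.
move=> gy; rewrite -invgR; apply: (subgroupV (lower_central_subgroup _)).
exact: commg_lower_central.
Qed.

(** The quotient of [gamma n.+1] by [gamma n.+2] is abelian, so its torsion elements form a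
    subgroup, and only the generating commutators need testing. *)
Lemma lower_central_radicalS n :
  (forall x y, gamma n x -> radical (gamma n.+2) [~ x, y]) ->
  gamma n.+1 `<=` radical (gamma n.+2).
Proof.
move=> Hn; set B := gamma n.+1 `&` radical (gamma n.+2).
suff: gamma n.+1 `<=` B by move=> sB x /sB [].
apply: generated_min => [|_ [x gx [y ->]]]; last first.
  by split; [apply: commg_lower_central | apply: Hn].
split=> [|x y [gx rx] [gy ry]].
  by split; [|apply: radical_sub]; apply: (lower_central_subgroup _).1.
split; first by apply: (lower_central_subgroup _).2.
apply: radicalM => //; last exact: radicalV.
exact: commg_lower_central_r.
Qed.

(* The n-th factor is generated by commutators that are multilinear in the
   images of their entries in G / [G, G]; some powers of the first two entries
   lie in the commutative set U modulo [G, G]. *)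
Lemma lower_central_radical (U : set G) :
  (forall u v, U u -> U v -> commute u v) ->
  (forall x, exists n u, [/\ (0 < n)%N, U u & gamma 1 (x ^+ n / u)]) ->
  forall n, gamma 1 `<=` radical (gamma n.+1).
Proof.
move=> cU rU.
(* Modulo [gamma n.+2], [[~ x ^+ k, y]] is the [k]-th power of [[~ x, y]], so torsion of the former
   passes to the latter. *)
have rad_commg n x y k : gamma n x ->
    radical (gamma n.+2) [~ x ^+ k, y] -> (0 < k)%N ->
    radical (gamma n.+2) [~ x, y].
  move=> gx rxk k0; apply: (radicalX k0).
  have gx' j : gamma n (x ^+ j) by apply: (subgroupX _ (lower_central_subgroup _)).
  have := @normal_commXg (gamma n.+2) x y k (lower_central_normal _).
  move=> /(_ (fun j => commg_lower_central _ (commg_lower_central _ (gx' j)))).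
  move/(subgroup_divC (lower_central_subgroup _)) => Mk.
  rewrite -(mulgVK [~ x ^+ k, y] ([~ x, y] ^+ k)).
  apply: radicalM => //; last exact: radical_sub.
  by apply: lower_centralS; apply: commg_lower_central_r.
have step n : gamma n.+1 `<=` radical (gamma n.+2).
  elim: n => [|n IHn]; apply: lower_central_radicalS => x y gx; last first.
    have [k k0 gxk] := IHn _ gx.
    apply: (rad_commg _ _ _ k) => //.
    by apply: radical_sub; apply: commg_lower_central.
  (* First factor: modulo [gamma 2], [[~ x ^+ n, y]] equals [[~ u, y]], whose [m]-th power is
     [[~ u, y ^+ m]], hence [[~ u, v] = 1]. *)
  have [n [u [n0 Uu gxu]]] := rU x; have [m [v [m0 Uv gyv]]] := rU y.
  apply: (rad_commg _ _ _ n) => //.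
  rewrite -(mulgVK u (x ^+ n)) commMgl.
  have g2 : gamma 2 [~ u, y ^+ m].
    rewrite -(mulgVK v (y ^+ m)) commgMr.
    have /commgP/eqP-> := cU _ _ Uu Uv; rewrite mul1g.
    by apply: (lower_central_normal 2).2; apply: commg_lower_central_r.
  have ru : radical (gamma 2) [~ u, y].
    exists m => //.
    have := @normal_commgX (gamma 2) u y m (lower_central_normal _).
    move=> /(_ (fun j => commg_lower_central _ (@commg_lower_central 0 _ _ I))).
    move/(subgroup_divC (lower_central_subgroup _)) => Mk.
    rewrite -(mulgVK [~ u, y ^+ m] ([~ u, y] ^+ m)).
    exact: (subgroupM (lower_central_subgroup _)).
  have gxu2 : gamma 2 ([~ x ^+ n / u, y] ^ u).
    by apply: (lower_central_normal 2).2; apply: commg_lower_central.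
  apply: radicalM => //; last exact: radical_sub.
  by apply: lower_centralS; apply: commg_lower_central_r.
elim=> [|n IHn] x gx; first exact: radical_sub.
have [k k0 gxk] := IHn x gx.
exact: (radicalX k0) (step _ _ gxk).
Qed.

End LowerCentralSeries.

(** * Homomorphisms and the lower central series *)

Section Morphisms.
Variables (G N : groupType) (f : {multiplicative G -> N}).

Lemma multiplicative1 : f 1 = 1.
Proof. by apply: (mulgI (f 1)); rewrite -gmulfM !mulg1. Qed.

Lemma multiplicativeV x : f x^-1 = (f x)^-1.
Proof. by apply: (mulgI (f x)); rewrite -gmulfM !mulgV multiplicative1. Qed.

Lemma multiplicativeX x n : f (x ^+ n) = f x ^+ n.
Proof.
by elim: n => [|n IHn]; rewrite ?multiplicative1 // !expgS gmulfM IHn.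
Qed.

Lemma multiplicative_lower_central n x :
  lower_central G n x -> lower_central N n (f x).
Proof.
elim: n x => [//|n IHn].
apply: (@generated_min _ _ [set x | lower_central N n.+1 (f x)]).
  split=> /= [|x y gx gy].
    by rewrite multiplicative1; apply: (lower_central_subgroup N n.+1).1.
  by rewrite gmulfM multiplicativeV; apply: (lower_central_subgroup N n.+1).2.
move=> _ [x gx [y ->]] /=.
rewrite /commg /conjg !gmulfM !multiplicativeV.
exact: commg_lower_central (IHn _ gx).
Qed.

End Morphisms.

(* Euclid's algorithm on the exponents: if n <= m then (a / b)^n = b^(m - n). *)
Lemma cyclic_common (G : groupType) (a b : G) (n m : nat) :
  torsion_free G -> commute a b -> (0 < n + m)%N -> a ^+ n = b ^+ m ->
  exists d, generated [set d] a /\ generated [set d] b.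
Proof.
move=> tfG; have [k] := ubnP (n + m); elim: k a b n m => // k IHk a b n m.
have gen1 x : generated [set x] (1 : G) by apply: (generated_subgroup _).1.
have genx (x : G) : generated [set x] x by apply: sub_generated.
rewrite ltnS => lenmk cab nm0 abnm.
have [n0|n0] := posnP n.
  by exists a; split=> //; rewrite (tfG b m) // -?abnm ?n0 // ; lia.
have [m0|m0] := posnP m.
  by exists b; split=> //; rewrite (tfG a n) // abnm ?m0.
have sub (x y : G) i j : commute x y -> (i <= j)%N -> x ^+ i = y ^+ j ->
    (x / y) ^+ i = y ^+ (j - i).
  by move=> cxy lij e; rewrite expgnFl // e expgnFr.
have [lenm|/ltnW lemn] := leqP n m.
  have /(IHk (a / b) b n (m - n)%N) : (n + (m - n) < k)%N by lia.
  case=> [| |//|d [da db]]; last 1 first.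
  - exists d; split=> //; rewrite -(mulgVK b a).
    exact: subgroupM (generated_subgroup _) da db.
  - by apply/commute_sym/commuteM/commuteV => //; exact: commute_sym.
  - by lia.
  - exact: sub.
have /(IHk (b / a) a m (n - m)%N) : (m + (n - m) < k)%N by lia.
case=> [| |//|d [db da]]; last 1 first.
- exists d; split=> //; rewrite -(mulgVK a b).
  exact: subgroupM (generated_subgroup _) db da.
- by apply/commute_sym/commuteM/commuteV.
- by lia.
- by apply: sub => //; exact: commute_sym.
Qed.

(** The generators are absorbed one at a time into a cyclic subgroup containing [c]: each has a
    positive power in [<c>], so [cyclic_common] applies to it and the current [d]. *)
Lemma cyclic_of_commensurable (G : groupType) (s : seq G) (c : G) :
  torsion_free G -> (forall x y : G, commute x y) ->
  generated [set` s] = setT ->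
  (forall x, radical (generated [set c]) x) ->
  exists d : G, generated [set d] = setT.
Proof.
move=> tfG cG sT rc.
suff [d [dc ds]] : exists d : G, generated [set d] c /\
    forall x, x \in s -> generated [set d] x.
  exists d; apply/seteqP; split=> // x _.
  have : generated [set` s] x by rewrite sT.
  by apply: generated_min => //; apply: generated_subgroup.
elim: s {sT} => [|x s [d [dc ds]]]; first by exists c; split=> //; apply: sub_generated.
have [n n0 /generated_min] := rc x.
move=> /(_ (generated [set d]) (generated_subgroup _)) cxn.
have /generated1P [m xm] : generated [set d] (x ^+ n).
  by apply: cxn => _ ->.
have [e [ex ed]] : exists e : G, generated [set e] x /\ generated [set e] d.
  case: xm => xm; first by apply: cyclic_common xm => //; lia.
  (* Exponents in [cyclic_common] are natural numbers, so a negative power of [d] is read as a power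
     of [d^-1]. *)
  have [||||e [ex ed]] := @cyclic_common G x d^-1 n m => //; first by lia.
    by rewrite expVgn.
  by exists e; split=> //; rewrite -(invgK d); apply: subgroupV (generated_subgroup _) _.
have de : generated [set d] `<=` generated [set e].
  by apply: generated_min => [|_ -> //]; apply: generated_subgroup.
exists e; split; first exact: de.
by move=> y; rewrite inE => /predU1P[->//|/ds /de].
Qed.

(** * Consequences of residual torsion-free nilpotence *)

Section ResiduallyTorsionFreeNilpotent.
Variable G : groupType.
Hypothesis rG : residually_torsion_free_nilpotent G.

Lemma residually_torsion_free : torsion_free G.
Proof.
move=> x n n0 xn1; apply: contrapT => /rG [N [f [tfN _ _]]]; apply.
by apply: tfN n0 _; rewrite -multiplicativeX xn1 multiplicative1.
Qed.

(** In a torsion-free nilpotent quotient some lower central term is trivial, so the image of [x] has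
    a trivial positive power and is itself trivial. *)
Lemma lower_central_radical_trivial x :
  (forall n, radical (lower_central G n.+1) x) -> x = 1.
Proof.
move=> rx; apply: contrapT => /rG [N [f [tfN [n gN] _]]]; apply.
have [k k0 gx] := rx n; apply: tfN k0 _.
have := multiplicative_lower_central f gx.
by move/lower_centralS; rewrite gN multiplicativeX.
Qed.

(** Taking [U] to be [<c>] in [lower_central_radical] puts [[G, G]] in the radical of every lower
    central term, so [G] is abelian, and the hypothesis then gives every element a positive power in
    [<c>]. *)
Lemma residually_nilpotent_cyclic (s : seq G) (c : G) :
  generated [set` s] = setT ->
  (forall x, exists n u,
    [/\ (0 < n)%N, generated [set c] u & lower_central G 1 (x ^+ n / u)]) ->
  exists d : G, generated [set d] = setT.
Proof.
move=> sT Hc.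
have cc u v : generated [set c] u -> generated [set c] v -> commute u v.
  have cX m n : commute (c ^+ m) (c ^+ n) by apply: commuteX2.
  move=> /generated1P[m [->|->]] /generated1P[n [->|->]] //.
  - exact: commuteV.
  - exact/commute_sym/commuteV.
  - by apply: commuteV; apply/commute_sym/commuteV.
have g1 x : lower_central G 1 x -> x = 1.
  move=> gx; apply: lower_central_radical_trivial => n.
  exact: (lower_central_radical cc Hc n gx).
apply: cyclic_of_commensurable sT _ => //.
- exact: residually_torsion_free.
- by move=> x y; apply/commgP/eqP/g1; apply: (@commg_lower_central _ 0).
- move=> x; have [n [u [n0 cu /g1 /divg1_eq xu]]] := Hc x.
  rewrite -xu in cu; exact (ex_intro2 _ _ n n0 cu).
Qed.

End ResiduallyTorsionFreeNilpotent.

(** * Rational functionals on finitely generated abelian groups *)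

Section RationalFunctional.
Local Open Scope ring_scope.
Variable A : zmodType.
Implicit Types (S : set A) (a g : A).

Definition is_addsubgroup S := S 0 /\ forall a b, S a -> S b -> S (a - b).

Lemma addsubgroupN S a : is_addsubgroup S -> S a -> S (- a).
Proof. by move=> [S0 SB] Sa; rewrite -sub0r; apply: SB. Qed.

Lemma addsubgroupD S a b : is_addsubgroup S -> S a -> S b -> S (a + b).
Proof.
by move=> gS Sa Sb; rewrite -(opprK b); apply: gS.2 => //; apply: addsubgroupN.
Qed.

Lemma addsubgroupMz S a (n : int) : is_addsubgroup S -> S a -> S (a *~ n).
Proof.
move=> gS Sa; have SX m : S (a *+ m).
  elim: m => [|m IHm]; first by rewrite mulr0n; apply: gS.1.
  by rewrite mulrS; apply: addsubgroupD.
case: n => n; first exact: SX.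
by rewrite NegzE mulrNz; apply: addsubgroupN => //; apply: SX.
Qed.

(** Equivalently, the tensor product of [A / S] with the rationals is a line spanned by the image of
    [g]. *)
Definition isolates S g :=
  (forall n : int, S (g *~ n) -> n = 0) /\
  forall a, exists2 n : int, n != 0 & exists k : int, S (a *~ n - g *~ k).

(** The value at [a] is [k / n] whenever [a *~ n] is [g *~ k] modulo [S]. *)
Lemma isolates_functional S g : is_addsubgroup S -> isolates S g ->
  exists phi : A -> rat,
    [/\ {morph phi : a b / a + b}, forall a, S a -> phi a = 0 & phi g = 1].
Proof.
move=> gS [Sg Sn].
have /choice[phi phiP] : forall a, exists q : rat, exists2 n : int, n != 0 &
    exists2 k : int, S (a *~ n - g *~ k) & q = k%:~R / n%:~R.
  by move=> a; have [n n0 [k Sk]] := Sn a; exists (k%:~R / n%:~R), n => //; exists k.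
have phi_eq a (n k : int) : n != 0 -> S (a *~ n - g *~ k) -> phi a = k%:~R / n%:~R.
  move=> n0 Sa; have [m m0 [l Sl ->]] := phiP a.
  (* Two fractions [k / n] and [l / m] for the same [a] agree because [g] has infinite order modulo
     [S]. *)
  have : S (g *~ (l * n - k * m)).
    have -> : g *~ (l * n - k * m)
        = (a *~ n - g *~ k) *~ m - (a *~ m - g *~ l) *~ n.
      by rewrite !mulrzBl -!mulrzA mulrzBr (mulrC n m) opprB [RHS]addrC addrA subrK.
    by apply: gS.2; apply: addsubgroupMz.
  move/Sg/eqP; rewrite subr_eq0 => /eqP e.
  apply/eqP; rewrite eqr_div ?intr_eq0 // -!intrM e mulrC.
  by [].
exists phi; split.
- move=> a b; have [n n0 [k Sk ea]] := phiP a; have [m m0 [l Sl eb]] := phiP b.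
  rewrite (phi_eq _ (n * m) (k * m + l * n)) ?mulf_neq0 //.
    rewrite ea eb addf_div ?intr_eq0 // -!intrM -intrD; congr (_%:~R / _).
  have -> : (a + b) *~ (n * m) - g *~ (k * m + l * n)
      = (a *~ n - g *~ k) *~ m + (b *~ m - g *~ l) *~ n.
    rewrite !mulrzBl mulrzDl mulrzDr -!mulrzA (mulrC m n) opprD.
    by rewrite addrACA.
  by apply: addsubgroupD => //; apply: addsubgroupMz.
- move=> a Sa; rewrite (phi_eq _ 1 0) ?mul0r // mulr1z mulr0z subr0.
  exact: Sa.
- by rewrite (phi_eq _ 1 1) ?divr1 // subrr; apply: gS.1.
Qed.

(* Adjoin the elements of s to S one at a time; g is the one after which A
   becomes torsion modulo the subgroup reached. *)
Lemma exists_isolated S (s : seq A) : is_addsubgroup S ->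
  (exists a, forall n : int, S (a *~ n) -> n = 0) ->
  (forall B, is_addsubgroup B -> S `<=` B -> [set` s] `<=` B -> B = setT) ->
  exists S' g, [/\ is_addsubgroup S', S `<=` S' & isolates S' g].
Proof.
elim: s S => [|g s IHs] S gS [a Sa] sB.
  have := Sa 1; rewrite (sB S) // => /(_ I) //.
pose S1 : set A := [set b | exists k : int, S (b - g *~ k)].
have gS1 : is_addsubgroup S1.
  split=> [|b c [k Sk] [l Sl]]; first by exists 0; rewrite mulr0z subr0; apply: gS.1.
  exists (k - l); rewrite mulrzBr.
  have -> : b - c - (g *~ k - g *~ l) = (b - g *~ k) - (c - g *~ l).
    by rewrite !opprB addrACA [RHS]addrACA (addrC (- c)).
  exact: gS.2.
have sS1 : S `<=` S1 by move=> b Sb; exists 0; rewrite mulr0z subr0.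
(* Here [S1] is [S] with [g] adjoined. If some element still has infinite order modulo [S1],
   recurse; otherwise [g] is the element sought. *)
have [a1|na1] := pselect (exists b, forall n : int, S1 (b *~ n) -> n = 0).
  have [|S' [h [gS' sS' iS']]] := IHs S1 gS1 a1; last first.
    by exists S', h; split=> //; apply: subset_trans sS'.
  move=> B gB sB1 ssB; apply: sB => //; first exact: subset_trans sB1.
  move=> b; rewrite /= inE => /predU1P[->|/ssB //].
  by apply: sB1; exists 1; rewrite mulr1z subrr; apply: gS.1.
have iS1 b : exists2 n : int, n != 0 & S1 (b *~ n).
  apply: contrapT => nb; apply: na1; exists b => n Sn.
  by apply: contrapT => /eqP n0; apply: nb; exists n.
exists S, g; split=> //; split=> [m Sm|b]; last first.
  by have [n n0 [k Sk]] := iS1 b; exists n => //; exists k.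
(* If [g] were torsion modulo [S], then [a], being torsion modulo [S1], would be torsion modulo
   [S]. *)
apply: contrapT => /eqP m0; have [n n0 [k Sk]] := iS1 a.
have /Sa/eqP : S (a *~ (n * m)).
  have -> : a *~ (n * m) = (a *~ n - g *~ k) *~ m + (g *~ m) *~ k.
    by rewrite mulrzBl -!mulrzA (mulrC k) subrK.
  by apply: addsubgroupD => //; apply: addsubgroupMz.
by rewrite mulf_eq0 (negPf n0) (negPf m0).
Qed.

End RationalFunctional.

(** * The abelianization as an additive group *)

Section Abelianization.
Variable G : groupType.
Local Notation gamma := (lower_central G).

Definition abel_rel (x y : G) : bool := `[< gamma 1 (x / y) >].

Lemma abel_rel_equiv : equiv_class_of abel_rel.
Proof.
have gG := lower_central_subgroup G 1.
split=> [x|x y|y x z]; rewrite /abel_rel.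
- by apply/asboolP; rewrite mulgV; apply: gG.1.
- by apply/asboolP/asboolP; apply: subgroup_divC.
- move=> /asboolP xy /asboolP yz; apply/asboolP.
  by rewrite -(mulgVK y x) -mulgA; apply: (subgroupM gG).
Qed.

Canonical abel_equiv := EquivRelPack abel_rel_equiv.

Definition abelianization := {eq_quot abel_equiv}%qT.
HB.instance Definition _ := Choice.on abelianization.

Definition abel (x : G) : abelianization := (\pi_abelianization x)%qT.

Lemma abelP x y : abel x = abel y <-> gamma 1 (x / y).
Proof.
split=> [/eqP|/asboolP xy]; first by rewrite eqmodE => /asboolP.
by apply/eqP; rewrite eqmodE.
Qed.

Lemma abel_surj (a : abelianization) : exists x, a = abel x.
Proof. by exists (repr a); rewrite /abel reprK. Qed.

Definition abel_add (a b : abelianization) := abel (repr a * repr b).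
Definition abel_opp (a : abelianization) := abel (repr a)^-1.

Lemma abel_addE x y : abel_add (abel x) (abel y) = abel (x * y).
Proof.
have nG := lower_central_normal G 1; apply/abelP.
have gx : gamma 1 (repr (abel x) / x) by apply/abelP; rewrite /abel reprK.
have gy : gamma 1 (repr (abel y) / y) by apply/abelP; rewrite /abel reprK.
move: (repr (abel x)) (repr (abel y)) gx gy => x' y' gx gy.
have -> : x' * y' / (x * y) = (x' / x) * (x * (y' / y) * x^-1).
  by rewrite ?gnorm; gsimpl.
exact: (subgroupM nG.1 gx (normal_conjV _ nG gy)).
Qed.

Lemma abel_oppE x : abel_opp (abel x) = abel x^-1.
Proof.
have nG := lower_central_normal G 1; apply/abelP; rewrite invgK.
have /abelP gx : abel x = abel (repr (abel x)) by rewrite /abel reprK.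
move: (repr _) gx => y gx.
have -> : y^-1 * x = y^-1 * (x / y) * y^-1^-1 by rewrite ?gnorm; gsimpl.
exact: (normal_conjV _ nG gx).
Qed.

Lemma abel_addA : associative abel_add.
Proof.
move=> a b c.
have [[x ->] [y ->] [z ->]] := And3 (abel_surj a) (abel_surj b) (abel_surj c).
by rewrite !abel_addE mulgA.
Qed.

Lemma abel_addC : commutative abel_add.
Proof.
move=> a b; have [[x ->] [y ->]] := conj (abel_surj a) (abel_surj b).
rewrite !abel_addE; apply/abelP; rewrite (commgCV x y) mulgK.
exact: (@commg_lower_central _ 0).
Qed.

Lemma abel_add0 : left_id (abel 1) abel_add.
Proof. by move=> a; have [x ->] := abel_surj a; rewrite abel_addE mul1g. Qed.

Lemma abel_addN : left_inverse (abel 1) abel_opp abel_add.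
Proof.
by move=> a; have [x ->] := abel_surj a; rewrite abel_oppE abel_addE mulVg.
Qed.

HB.instance Definition _ := GRing.isZmodule.Build abelianization
  abel_addA abel_addC abel_add0 abel_addN.

Lemma abelM x y : abel (x * y) = (abel x + abel y)%R.
Proof. by rewrite -abel_addE. Qed.

Lemma abel1 : abel 1 = 0%R. Proof. by []. Qed.

Lemma abelV x : abel x^-1 = (- abel x)%R.
Proof. by rewrite -abel_oppE. Qed.

Lemma abelX x n : abel (x ^+ n) = (abel x *+ n)%R.
Proof.
by elim: n => [|n IHn]; rewrite ?mulr0n // expgS abelM IHn mulrS.
Qed.

Lemma abel_eq0 x : abel x = 0%R <-> gamma 1 x.
Proof. by rewrite -abel1 abelP divg1. Qed.

End Abelianization.

(* The two cases are whether or not G / [G, G]<c> is torsion. *)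
Lemma cyclic_or_rational_functional (G : groupType) (s : seq G) (c : G) :
  residually_torsion_free_nilpotent G -> generated [set` s] = setT ->
  (exists d : G, generated [set d] = setT) \/
  exists phi : G -> rat, [/\ {morph phi : x y / x * y >-> (x + y)%R},
    phi c = 0%R & exists x, x \in s /\ phi x <> 0%R].
Proof.
move=> rG sT.
pose S : set (abelianization G) := [set a | exists k : int, a = (abel c *~ k)%R].
have gS : is_addsubgroup S.
  split=> [|_ _ [k ->] [l ->]]; first by exists 0%R; rewrite mulr0z.
  by exists (k - l)%R; rewrite mulrzBr.
have Sc : S (abel c) by exists 1%R; rewrite mulr1z.
have [a|na] := pselect (exists a, forall n : int, S (a *~ n)%R -> n = 0%R).
  right; have [|S' [g [gS' sS' iS']]] := @exists_isolated _ S (map (@abel G) s) gS a.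
    move=> B gB _ sB; apply/seteqP; split=> // b _.
    have [x ->] := abel_surj b.
    have : generated [set` s] x by rewrite sT.
    move: x; apply: (@generated_min _ _ [set x | B (abel x)]).
      split=> /= [|x y Bx By]; first by rewrite abel1; apply: gB.1.
      by rewrite abelM abelV; apply: gB.2.
    by move=> x xs /=; apply: sB; rewrite /= map_f.
  have [phi [phiD phiS phig]] := isolates_functional gS' iS'.
  have phiM : {morph (phi \o @abel G) : x y / x * y >-> (x + y)%R}.
    by move=> x y /=; rewrite abelM phiD.
  exists (phi \o @abel G); split=> //; first by rewrite /= phiS //; apply: sS'.
  apply: contrapT => nx.
  have [x gx] := abel_surj g; have : generated [set` s] x by rewrite sT.
  (* A functional vanishing on the generators vanishes on all of [G], against [phi g = 1]. *)
  suff /[apply] : generated [set` s] `<=` [set x | phi (abel x) = 0%R].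
    by rewrite /= -gx phig.
  apply: generated_min => [|y ys]; last by apply: contrapT => y0; apply: nx; exists y.
  have phi0 : phi (abel (1 : G)) = 0%R by rewrite abel1 phiS //; apply: gS'.1.
  split=> // y z /= y0 z0; have := phiM (y / z) z.
  by rewrite /= mulgVK y0 z0 addr0.
left; apply: (residually_nilpotent_cyclic rG sT (c := c)) => x.
have [n n0 [k xk]] : exists2 n, (0 < n)%N & S (abel x *+ n)%R.
  apply: contrapT => nn; apply: na; exists (abel x) => n Sn.
  apply: contrapT => n0; apply: nn; exists `|n|%N; first by lia.
  rewrite pmulrn; have [->//|->] : (`|n|%N : int) = n \/ (`|n|%N : int) = (- n)%R by lia.
  by rewrite mulrNz; apply: addsubgroupN.
have gC := generated_subgroup [set c].
have gc j : generated [set c] (c ^+ j).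
  by apply: (subgroupX _ gC); apply: sub_generated.
case: k xk => k xk.
  exists n, (c ^+ k); split=> //; apply/abel_eq0.
  by rewrite abelM abelV !abelX xk subrr.
(* [Negz k] denotes [-(k + 1)], whence the exponent [k.+1]. *)
exists n, (c ^- k.+1); split=> //; first exact: (subgroupV gC).
by apply/abel_eq0; rewrite abelM !abelV !abelX xk NegzE mulrNz subrr.
Qed.

(** * Positive cones and invariant orders on cosets *)

Section Cones.
Variables (G : groupType) (C : set G).
Hypothesis gC : is_subgroup C.

(* The properties of [set x | C < x C] for an invariant order on G / C, apart
   from totality. *)
Definition is_cone (P : set G) :=
  [/\ forall x y, P x -> P y -> P (x * y),
      forall x y, C x -> P y -> P (x * y) /\ P (y * x)
    & forall x, P x -> ~ C x].

Lemma translate_eqP (x y : G) : translate x C = translate y C <-> C (x^-1 * y).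
Proof.
split=> [e|xy].
  have : translate y C y by exists 1; [exact: gC.1 | rewrite mulg1].
  by rewrite -e => -[c Cc <-]; rewrite mulKg.
apply/seteqP; split=> _ [c Cc <-].
  exists (y^-1 * x * c); last by rewrite ?gnorm; gsimpl.
  apply: (subgroupM gC) => //.
  by have := subgroupV gC xy; rewrite invgM invgK.
exists (x^-1 * y * c); last by rewrite ?gnorm; gsimpl.
exact: (subgroupM gC).
Qed.

Lemma translateM (x y : G) : translate x (translate y C) = translate (x * y) C.
Proof.
apply/seteqP; split=> [_ [_ [c Cc <-] <-]|_ [c Cc <-]].
  by exists c; rewrite // mulgA.
by exists (y * c); [exists c | rewrite mulgA].
Qed.

(** Put [x C < y C] when [x^-1 * y] lies in [P]: this element is unchanged by left translation, and
    products in [P] give transitivity. *)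
Lemma cone_left_relatively_convex (P : set G) : is_cone P ->
  (forall x, ~ C x -> P x \/ P x^-1) -> left_relatively_convex C.
Proof.
move=> [PM PC CP] Ptot.
pose lt A B := exists x y, [/\ A = translate x C, B = translate y C & P (x^-1 * y)].
have ltE x y : lt (translate x C) (translate y C) = P (x^-1 * y).
  apply/propext; split=> [[x' [y' [/translate_eqP xx' /translate_eqP yy' Pxy]]]|Pxy];
    last by exists x, y.
  (* Other representatives alter [x^-1 * y] by factors from [C] on both sides, which [P] absorbs. *)
  have -> : x^-1 * y = (x^-1 * x') * ((x'^-1 * y') * (y^-1 * y')^-1).
    by rewrite ?gnorm; gsimpl.
  by apply: (PC _ _ xx' _).1; apply: (PC _ _ (subgroupV gC yy') Pxy).2.
have PNV x : P x -> ~ P x^-1.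
  by move=> Px PVx; apply: (CP (x * x^-1)); [exact: PM | rewrite mulgV; exact: gC.1].
exists lt; split; first split.
- move=> _ _ _ [x _ <-] [y _ <-] [z _ <-].
  rewrite !ltE => xy yz; by have := PM _ _ xy yz; rewrite -mulgA mulVKg.
- move=> _ _ [x _ <-] [y _ <-].
  have yx : y^-1 * x = (x^-1 * y)^-1 by rewrite invgM invgK.
  rewrite !ltE yx; have := translate_eqP x y; move: (_ = _) => E EC.
  have [Cxy|nCxy] := pselect (C (x^-1 * y)).
    constructor 2; split; [|exact/EC|] => Pxy; last exact: CP _ Pxy (subgroupV gC Cxy).
    exact: CP _ Pxy Cxy.
  have nE : ~ E by move/EC.
  have [Pxy|Pxy] := Ptot _ nCxy; first by constructor 1; split=> //; apply: PNV.
  by constructor 3; split=> // /PNV.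
- move=> g _ _ [x _ <-] [y _ <-]; rewrite !translateM !ltE.
  by rewrite invgM -mulgA mulKg.
Qed.

(* The limit of the cones of the finite sets along an ultrafilter on seq G that
   contains [set t | x \in t] for every x. *)
Lemma cone_compactness :
  (forall s : seq G, exists P : set G,
    is_cone P /\ forall x, x \in s -> ~ C x -> P x \/ P x^-1) ->
  left_relatively_convex C.
Proof.
move=> /choice[P PP].
have cP s : is_cone (P s) by have [] := PP s.
have Ps s : forall x, x \in s -> ~ C x -> P s x \/ P s x^-1 by have [] := PP s.
pose F : set_system (seq G) :=
  [set A | exists s : seq G, forall t : seq G, {subset s <= t} -> A t].
have FF : ProperFilter F.
  split=> [[s]|]; first by move/(_ s); apply.
  split=> [|A B [s As] [t Bt]|A B AB [s As]]; first by exists [::].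
    exists (s ++ t) => u su; split; [apply: As | apply: Bt] => x xs;
      by apply: su; rewrite mem_cat xs ?orbT.
  by exists s => t /As /AB.
have [U [UU FU]] := ultraFilterLemma FF.
have sU A B : A `<=` B -> U A -> U B by apply: filterS.
have IU A B : U A -> U B -> U (A `&` B) by apply: filterI.
apply: (@cone_left_relatively_convex [set x | U [set s | P s x]]).
  split=> [x y Ux Uy|x y Cx Uy|x Ux Cx] /=.
  - by apply: sU (IU _ _ Ux Uy) => s [Px Py]; have [PM _ _] := cP s; apply: PM.
  - by split; apply: sU Uy => s Py; have [_ PC _] := cP s; have [] := PC _ _ Cx Py.
  - suff : U set0 by apply: filter_not_empty.
    apply: sU Ux => s Px; have [_ _ CP] := cP s; exact: CP Px Cx.
(* If [x] is not positive in the limit, then [U]-almost every [s] contains [x] and has [x] outside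
   [P s], which forces [x^-1] into [P s]. *)
move=> x nCx /=; have [?|nUx] := in_ultra_setVsetC [set s | P s x] UU; first by left.
right; have Ux : U [set t : seq G | x \in t].
  by apply: FU; exists [:: x] => t; apply; rewrite inE.
by apply: sU (IU _ _ nUx Ux) => s [nPx /Ps /(_ nCx) []].
Qed.

End Cones.

(** A homomorphism on a subgroup [H] is represented by a function on all of [G] that is additive on
    [H] only. *)
Lemma additive1 (G : groupType) (H : set G) (phi : G -> rat) : H 1 ->
  (forall x y, H x -> H y -> phi (x * y) = (phi x + phi y)%R) -> phi 1 = 0%R.
Proof. by move=> H1 /(_ 1 1 H1 H1); rewrite mulg1; lra. Qed.

Lemma additiveV (G : groupType) (H : set G) (phi : G -> rat) x : is_subgroup H ->
  (forall x y, H x -> H y -> phi (x * y) = (phi x + phi y)%R) ->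
  H x -> phi x^-1 = (- phi x)%R.
Proof.
move=> gH phiM Hx; have := phiM _ _ (subgroupV gH Hx) Hx.
by rewrite mulVg (additive1 gH.1 phiM); lra.
Qed.

(** * Functionals and finite cones for a maximal cyclic subgroup *)

Section MaximalCyclic.
Variables (G : groupType) (C : set G).
Hypothesis hG : locally_residually_torsion_free_nilpotent G.
Hypothesis hC : maximal_cyclic_subgroup C.

(** [H] is generated by [s] and a generator [c] of [C]. It is not cyclic: by maximality a cyclic
    group containing it would be [C], which omits [z0]. So the other alternative of
    [cyclic_or_rational_functional] holds. *)
Lemma maximal_cyclic_functional (s : seq G) (z0 : G) :
  z0 \in s -> ~ C z0 ->
  exists (H : set G) (phi : G -> rat),
    [/\ is_subgroup H, C `<=` H & [set` s] `<=` H] /\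
    [/\ forall x y, H x -> H y -> phi (x * y) = (phi x + phi y)%R,
        forall x, C x -> phi x = 0%R & exists x, x \in s /\ phi x <> 0%R].
Proof.
move=> z0s nCz0; have [[c Cc] Cmax] := hC.
pose t := c :: s; have gH := generated_subgroup [set` t].
have /is_subgroupP cH := gH; pose H := Subgroup cH.
have tH x : x \in t -> x \in (H : set G) by move=> xt; rewrite inE; apply: sub_generated.
pose K : groupType := subgroup_type H.
have HK x : (H : set G) x -> exists k : K, val k = x.
  move=> Hx; have xH : x \in (H : set G) by rewrite inE.
  by exists (Sub x xH); rewrite SubK.
(* [k] inverts [val] on [H] and is unconstrained elsewhere, so later inductions carry membership in
   [H] along. *)
have /choice[k kP] : forall x, exists k : K, (H : set G) x -> val k = x.
  by move=> x; have [/HK[k kx]|nH] := pselect ((H : set G) x); [exists k | exists 1].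
have kM x y : (H : set G) x -> (H : set G) y -> k (x * y) = k x * k y.
  move=> Hx Hy; apply: val_inj; rewrite valM !kP //.
  exact: (subgroupM gH).
have kV (z : K) : k (val z) = z.
  by apply: val_inj; rewrite kP //; have := valP z; rewrite inE.
have tT : generated [set` map k t] = setT.
  apply/seteqP; split=> // z _.
  have Hz : (H : set G) (val z) by have := valP z; rewrite inE.
  have gk := generated_subgroup [set` map k t].
  suff : (H : set G) `<=` [set x | generated [set` map k t] (k x)].
    by move=> /(_ _ Hz) /=; rewrite kV.
  suff : (H : set G) `<=` [set x | (H : set G) x /\ generated [set` map k t] (k x)].
    by move=> sH x /sH [].
  apply: generated_min => [|x xt]; last first.
    by split; apply: sub_generated => //; apply: (map_f k xt).
  split=> [|x y [Hx kx] [Hy ky]].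
    split; first exact: gH.1.
    suff -> : k 1 = 1 by apply: gk.1.
    by apply: val_inj; rewrite val1 kP //; apply: gH.1.
  split; first exact: gH.2.
  have HV : (H : set G) y^-1 by apply: (subgroupV gH).
  rewrite kM //; suff -> : k y^-1 = (k y)^-1 by apply: gk.2.
  by apply: (mulgI (k y)); rewrite -kM // !mulgV; apply: val_inj; rewrite val1 kP //;
    apply: gH.1.
have rK : residually_torsion_free_nilpotent K by apply: hG; exists t.
have Hc : (H : set G) c by apply: sub_generated; rewrite /= inE eqxx.
have sH : [set` s] `<=` H.
  by move=> x xs; apply: sub_generated; rewrite /= inE xs orbT.
have CH : C `<=` H by rewrite Cc; apply: generated_min => // _ ->.
have [[d dT]|[phi [phiM phic [z [zs phiz]]]]] :=
  cyclic_or_rational_functional (k c) rK tT.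
  have Hd : (H : set G) `<=` generated [set val d].
    move=> x Hx; rewrite -(kP x Hx).
    have gd := generated_subgroup [set val d].
    have : generated [set d] (k x) by rewrite dT.
    move: (k x); apply: (@generated_min _ _ [set z | generated [set val d] (val z)]).
      by split=> [|y z dy dz] /=; rewrite ?val1 ?gmulfF; [exact: gd.1 | exact: gd.2].
    by move=> _ -> /=; apply: sub_generated.
  case: nCz0; rewrite -(Cmax (generated [set val d])).
  - exact: Hd (sH _ z0s).
  - by exists (val d).
  - by move=> x /CH /Hd.
have phikM x y : (H : set G) x -> (H : set G) y ->
    (phi \o k) (x * y) = ((phi \o k) x + (phi \o k) y)%R.
  by move=> Hx Hy /=; rewrite kM.
exists H, (phi \o k); split=> //; split=> //.
- rewrite Cc; suff : generated [set c] `<=` [set x | (H : set G) x /\ phi (k x) = 0%R].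
    by move=> sC x /sC [].
  apply: generated_min => [|_ -> //]; split=> [|x y [Hx x0] [Hy y0]].
    by split; [exact: gH.1 | exact: additive1 gH.1 phikM].
  split; first exact: gH.2.
  have := additiveV gH phikM Hy; have := phikM _ _ Hx (subgroupV gH Hy).
  by rewrite /= x0 y0 => -> ->; rewrite oppr0 addr0.
- move: zs; rewrite /= inE => /predU1P[zc|/mapP[x xs zx]]; first by rewrite zc in phiz.
  by exists x; rewrite /= -zx.
Qed.

(** The cone is lexicographic: the sign of [phi] decides first, and a cone for the elements of [s]
    killed by [phi] decides ties. *)
Lemma maximal_cyclic_finite_cone (s : seq G) :
  exists P : set G, is_cone C P /\ forall x, x \in s -> ~ C x -> P x \/ P x^-1.
Proof.
have gC : is_subgroup C by have [[c ->] _] := hC; apply: generated_subgroup.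
have [n] := ubnP (size s); elim: n s => // n IHn s; rewrite ltnS => sn.
have [[x0 x0s nCx0]|nC] := pselect (exists2 x, x \in s & ~ C x); last first.
  by exists set0; split=> [|x xs nCx]; [split | case: nC; exists x].
have [H [phi [[gH CH sH] [phiM phiC [x1 [x1s phix1]]]]]] :=
  maximal_cyclic_functional x0s nCx0.
(* The filtered list is strictly shorter since it omits [x1]. *)
have [|P [[PM PC CP] Ps]] := IHn [seq x <- s | phi x == 0%R].
  apply: leq_trans sn; rewrite size_filter -(count_predC (fun x => phi x == 0%R) s).
  rewrite -addn1 leq_add2l -has_count; apply/hasP; exists x1 => //.
  exact/eqP.
(* The cone is cut down to [H], where [phi] is additive; [P] itself may leave [H]. *)
exists [set x | H x /\ ((0 < phi x)%R \/ (phi x = 0%R /\ P x))]; split.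
  split=> [x y [Hx px] [Hy py]|x y Cx [Hy py]|x [Hx px] Cx].
  - split; first exact: (subgroupM gH).
    rewrite (phiM _ _ Hx Hy).
    case: px => [px|[px Px]]; case: py => [py|[py Py]]; [left; lra..|right].
    by rewrite px py addr0; split=> //; apply: PM.
  - have Hx := CH _ Cx; rewrite /= !phiM // (phiC _ Cx) addr0 add0r.
    have Hxy := subgroupM gH Hx Hy; have Hyx := subgroupM gH Hy Hx.
    split; split=> //; case: py => [|[py Py]]; by [left | right; have [] := PC _ _ Cx Py].
  - by case: px => [|[_ /CP //]]; rewrite phiC // ltxx.
move=> x xs nCx; have Hx := sH _ xs; have HV := subgroupV gH Hx.
rewrite /= (additiveV gH phiM Hx).
have [phix|phix|phix] := ltrgtP (phi x) 0%R.
- by right; split=> //; left; lra.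
- by left; split=> //; left.
- have /Ps/(_ nCx) : x \in [seq x <- s | phi x == 0%R] by rewrite mem_filter phix eqxx.
  by rewrite phix oppr0; case=> Px; [left | right]; split=> //; right.
Qed.

End MaximalCyclic.

Theorem mainTheorem8 (G : groupType)
    (hG : locally_residually_torsion_free_nilpotent G)
    (C : subgroup G) (hC : maximal_cyclic_subgroup C) :
  left_relatively_convex C.
Proof.
apply: cone_compactness; last exact: maximal_cyclic_finite_cone.
exact/is_subgroupP/subgroup_closed.
Qed.
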